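(* Let $N\ge 1$, let $\mathcal{X}\in\mathbb{R}^{I_1\times\cdots\times I_N}$ be a tensor with set of observable entries $\Omega$, let $\lambda>0$, and let $\mathcal{G}\in\mathbb{R}^{J_1\times\cdots\times J_N}$ and $\mathbf{A}^{(k)}\in\mathbb{R}^{I_k\times J_k}$ ($k=1,\dots,N$). Define $$L_1(\mathcal{G},\mathbf{A}^{(1)},\dots,\mathbf{A}^{(N)})=\sum_{\alpha=(i_1,\dots,i_N)\in\Omega}\Big(\mathcal{X}_\alpha-\sum_{\beta=(j_1,\dots,j_N)}\mathcal{G}_\beta\prod_{k=1}^N a^{(k)}_{i_kj_k}\Big)^2+\lambda\Big(\|\mathcal{G}\|_1+\sum_{k=1}^N\|\mathbf{A}^{(k)}\|_1\Big).$$ Fix a mode $n$ and indices $1\le i_n\le I_n$, $1\le j_n\le J_n$. Regard $L_1$ as a function of the single real variable $a^{(n)}_{i_nj_n}$, all other entries of $\mathcal{G},\mathbf{A}^{(1)},\dots,\mathbf{A}^{(N)}$ being held fixed. Put $$g_{fm}=-2\Big(\sum_{\alpha\in\Omega^{(n)}_{i_n}}\mathcal{X}_\alpha\,\delta^{(n)}_\alpha(j_n)-\sum_{t\ne j_n}v^{(n)}_{i_nj_n}(t)\,a^{(n)}_{i_nt}\Big),\qquad d_{fm}=2\,v^{(n)}_{i_nj_n}(j_n),$$ where $t$ ranges over $\{1,\dots,J_n\}\setminus\{j_n\}$. Then $$\operatorname*{arg\,min}_{a^{(n)}_{i_nj_n}}L_1(\mathcal{G},\mathbf{A}^{(1)},\dots,\mathbf{A}^{(N)})=\begin{cases}(\lambda-g_{fm})/d_{fm}&\text{if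 }g_{fm}>\lambda,\\-(\lambda+g_{fm})/d_{fm}&\text{if }g_{fm}<-\lambda,\\0&\text{otherwise.}\end{cases}$$
   Context: $\Omega\subseteq\{1,\dots,I_1\}\times\cdots\times\{1,\dots,I_N\}$ is the set of indices of observed entries of $\mathcal{X}$; $\Omega^{(n)}_{i_n}$ is the subset of $\Omega$ consisting of the multi-indices whose $n$-th component equals $i_n$. $a^{(k)}_{ij}$ denotes the $(i,j)$ entry of $\mathbf{A}^{(k)}$. $\|\cdot\|_1$ is the sum of the absolute values of all entries (of a tensor or matrix). $\beta=(j_1,\dots,j_N)$ ranges over all indices of $\mathcal{G}$. For $\alpha=(i_1,\dots,i_N)\in\Omega$ and $1\le j\le J_n$, $$\delta^{(n)}_\alpha(j)=\sum_{\beta=(j_1,\dots,j_N):\,j_n=j}\mathcal{G}_\beta\prod_{k\ne n}a^{(k)}_{i_kj_k},$$ the sum being over all core-tensor indices whose $n$-th component is $j$. For $1\le j\le J_n$, $$v^{(n)}_{i_nj_n}(j)=\sum_{\alpha\in\Omega^{(n)}_{i_n}}\delta^{(n)}_\alpha(j)\,\delta^{(n)}_\alpha(j_n).$$ *)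

(* Defs.v *)
From mathcomp Require Import all_boot all_order all_algebra.
From mathcomp Require Import classical_sets reals.

Set Implicit Arguments.
Unset Strict Implicit.
Unset Printing Implicit Defensive.

Import Order.TTheory GRing.Theory Num.Theory.
Local Open Scope ring_scope.

(* Modes and indices are numbered from 0. *)
Definition multi_index (N : nat) (D : 'I_N -> nat) :=
  {dffun forall k : 'I_N, 'I_(D k)}.

Definition tensor (R : Type) (N : nat) (D : 'I_N -> nat) :=
  {ffun multi_index D -> R}.

Definition factors (R : Type) (N : nat) (I J : 'I_N -> nat) :=
  forall k : 'I_N, 'M[R]_(I k, J k).

Definition argmin (R : realType) (f : R -> R) : set R :=
  [set x | forall y, f x <= f y]%classic.

Definition mx_set_entry (R : Type) (m p : nat) (M : 'M[R]_(m, p))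
    (i : 'I_m) (j : 'I_p) (x : R) : 'M[R]_(m, p) :=
  \matrix_(i', j') (if (i' == i) && (j' == j) then x else M i' j').

Definition set_factor_entry (R : Type) (N : nat) (I J : 'I_N -> nat)
    (A : factors R I J) (n : 'I_N) (i : 'I_(I n)) (j : 'I_(J n)) (x : R) :
    factors R I J :=
  dfwith A (mx_set_entry (A n) i j x).

Section Tucker.
Variables (R : realType) (N : nat) (I J : 'I_N -> nat).
Implicit Types (X : tensor R I) (Omega : {set multi_index I}).
Implicit Types (G : tensor R J) (A : factors R I J).

Definition tensor_norm1 (D : 'I_N -> nat) (T : tensor R D) : R :=
  \sum_(beta : multi_index D) `|T beta|.

Definition mx_norm1 (m p : nat) (M : 'M[R]_(m, p)) : R :=
  \sum_(i < m) \sum_(j < p) `|M i j|.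

Definition L1_loss X Omega (lambda : R) G A : R :=
  \sum_(alpha in Omega)
     (X alpha - \sum_(beta : multi_index J)
                   G beta * \prod_(k < N) A k (alpha k) (beta k)) ^+ 2
  + lambda * (tensor_norm1 G + \sum_(k < N) mx_norm1 (A k)).

Definition Omega_slice Omega (n : 'I_N) (i : 'I_(I n)) : {set multi_index I} :=
  [set alpha in Omega | alpha n == i].

Definition delta G A (n : 'I_N) (alpha : multi_index I) (j : 'I_(J n)) : R :=
  \sum_(beta : multi_index J | beta n == j)
     G beta * \prod_(k < N | k != n) A k (alpha k) (beta k).

Definition v_fm Omega G A (n : 'I_N) (i : 'I_(I n)) (j t : 'I_(J n)) : R :=
  \sum_(alpha in Omega_slice Omega i) delta G A alpha t * delta G A alpha j.

Definition g_fm X Omega G A (n : 'I_N) (i : 'I_(I n)) (j : 'I_(J n)) : R :=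
  - 2 * (\sum_(alpha in Omega_slice Omega i) X alpha * delta G A alpha j
         - \sum_(t < J n | t != j) v_fm Omega G A i j t * A n i t).

Definition d_fm Omega G A (n : 'I_N) (i : 'I_(I n)) (j : 'I_(J n)) : R :=
  2 * v_fm Omega G A i j j.

End Tucker.

(* Main.v *)
(* As a function of x = a^(n)_{i_n j_n}, the model is affine with slope
   delta_alpha(j_n) on the slice alpha_n = i_n and constant elsewhere, so that
   L_1(x) = L_1(0) + (d/2) x^2 + g x + lambda |x|.  If d = 0, then delta_alpha(j_n)
   vanishes on the whole slice, hence g = 0 and the minimizer is 0; otherwise
   the function is strongly convex and is minimized by soft thresholding. *)
Require Import Defs.
From mathcomp Require Import all_boot all_order all_algebra.
From mathcomp Require Import classical_sets reals.
From mathcomp Require Import boolp ring lra.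

Import Order.TTheory GRing.Theory Num.Theory.
Local Open Scope ring_scope.

Lemma argmin_eq_set1 (R : realType) (f : R -> R) (x0 : R) :
  (forall y, y != x0 -> f x0 < f y) -> argmin f = [set x0]%classic.
Proof.
move=> lt_f; apply/seteqP; split=> [x min_x | x -> y] /=.
  by apply/eqP; apply: contraT => /lt_f; rewrite ltNge min_x.
by have [-> // | /lt_f/ltW] := eqVneq y x0.
Qed.

(** For [d > 0], replacing [|y|] by a supporting line at the candidate [x] leaves a parabola with
    vertex [x]. Hence the value at [y] exceeds the value at [x] by at least [d / 2 * (y - x) ^+ 2],
    which makes the minimizer unique. *)
Lemma argmin_soft_threshold (R : realType) (c d g lambda : R) :
  0 < lambda -> 0 <= d -> (d = 0 -> g = 0) ->
  argmin (fun x => c + d / 2 * x ^+ 2 + g * x + lambda * `|x|)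
  = [set (if lambda < g then (lambda - g) / d
          else if g < - lambda then - (lambda + g) / d
          else 0)]%classic.
Proof.
move=> lambda_gt0 d_ge0 g_eq0; apply: argmin_eq_set1 => y.
have [d0 | d_neq0] := eqVneq d 0.
  (* With [g = 0] neither threshold is passed, so no quotient by [d = 0] is selected and only the
     penalty remains. *)
  rewrite d0 (g_eq0 d0) oppr_gt0 !(lt_gtF lambda_gt0) => y_neq0.
  by rewrite !mul0r normr0 !mulr0 !addr0 ltrDl mulr_gt0 ?normr_gt0.
have d_gt0 : 0 < d by rewrite lt_def d_neq0.
have ly (b : R) : b <= `|y| -> lambda * b <= lambda * `|y|.
  by move=> ?; rewrite ler_pM2l.
(* The two supporting lines of the penalty: [lyP] serves a positive candidate, [lyN] a negative
   one. *)
have lyP := ly _ (ler_norm y).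
have lyN : lambda * - y <= lambda * `|y| by rewrite ly // -normrN ler_norm.
have sq_gt0 x : y != x -> 0 < d * (y - x) ^+ 2.
  by move=> neq_yx; rewrite mulr_gt0 // exprn_even_gt0 // subr_eq0.
case: ltP => [lt_lg | le_gl].
  set x := _ / d => /sq_gt0; have dx : d * x = lambda - g by rewrite /x; field.
  have x_lt0 : x < 0 by rewrite /x pmulr_llt0 ?invr_gt0 // subr_lt0.
  (* Eliminating [d * x] through [dx] leaves an inequality that is linear in the remaining
     monomials. *)
  have -> : d / 2 * x ^+ 2 = (lambda - g) * x / 2 by rewrite -dx; ring.
  have -> : d * (y - x) ^+ 2 =
      d * y ^+ 2 - 2 * (d * x) * y + (d * x) * x by ring.
  by rewrite dx (ltr0_norm x_lt0); lra.
case: ltP => [lt_gl | le_lg]; last first.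
  move=> /sq_gt0; rewrite subr0 normr0.
  (* Here [g] lies between [- lambda] and [lambda], so the penalty absorbs the linear term. *)
  have : 0 <= g * y + lambda * `|y| by case: (ger0P y) => y0; nra.
  by lra.
set x := _ / d => /sq_gt0; have dx : d * x = - (lambda + g) by rewrite /x; field.
have x_gt0 : 0 < x by rewrite /x pmulr_lgt0 ?invr_gt0 //; lra.
have -> : d / 2 * x ^+ 2 = - (lambda + g) * x / 2 by rewrite -dx; ring.
have -> : d * (y - x) ^+ 2 =
    d * y ^+ 2 - 2 * (d * x) * y + (d * x) * x by ring.
by rewrite dx (gtr0_norm x_gt0); lra.
Qed.

Lemma mx_set_entryE (R : nzRingType) (m p : nat) (M : 'M[R]_(m, p))
    (i : 'I_m) (j : 'I_p) (x : R) i' j' :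
  mx_set_entry M i j x i' j'
  = mx_set_entry M i j 0 i' j' + (x *+ (i' == i)) *+ (j' == j).
Proof.
by rewrite !mxE; case: eqP; case: eqP => //= _ _; rewrite ?addr0 ?add0r.
Qed.

Lemma mx_norm1_set_entry (R : realType) (m p : nat) (M : 'M[R]_(m, p))
    (i : 'I_m) (j : 'I_p) (x : R) :
  mx_norm1 (mx_set_entry M i j x) = mx_norm1 (mx_set_entry M i j 0) + `|x|.
Proof.
(* Spreading [|x|] over the matrix as a sum supported at [(i, j)] reduces the claim to one entry at
   a time. *)
have -> : `|x| = \sum_(i' < m) \sum_(j' < p) (`|x| *+ (i' == i)) *+ (j' == j).
  rewrite (bigD1 i) //= [X in _ + X]big1 => [|k /negPf ->]; last first.
    by rewrite big1 // => l _; rewrite mul0rn.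
  rewrite addr0 (bigD1 j) //= [X in _ + X]big1 => [|l /negPf -> //].
  by rewrite !eqxx addr0.
rewrite -big_split; apply: eq_bigr => i' _; rewrite -big_split.
apply: eq_bigr => j' _; rewrite /= !mxE.
by case: eqP; case: eqP => //= _ _; rewrite ?normr0 ?addr0 ?add0r.
Qed.

Section SetFactorEntry.
Variables (R : realType) (N : nat) (I J : 'I_N -> nat).
Variables (X : tensor R I) (Omega : {set multi_index I}) (lambda : R).
Variables (G : tensor R J) (A : factors R I J).
Variables (n : 'I_N) (i : 'I_(I n)) (j : 'I_(J n)).

Implicit Types (alpha : multi_index I).

Definition tucker_model (B : factors R I J) alpha :=
  \sum_(beta : multi_index J) G beta * \prod_(k < N) B k (alpha k) (beta k).

(** Grouping the core indices by their [n]-th component pulls the mode-[n] factor out of each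
    product. *)
Lemma model_delta (B : factors R I J) alpha :
  tucker_model B alpha = \sum_(t < J n) delta G B alpha t * B n (alpha n) t.
Proof.
rewrite /tucker_model.
rewrite (partition_big (fun beta : multi_index J => beta n) xpredT) //=.
apply: eq_bigr => t _; rewrite big_distrl /=; apply: eq_bigr => beta /eqP <-.
by rewrite (bigD1 n) //= mulrCA mulrC.
Qed.

(** The product in [delta] skips mode [n], the only mode that is modified. *)
Lemma delta_set_factor_entry x alpha (t : 'I_(J n)) :
  delta G (set_factor_entry A i j x) alpha t = delta G A alpha t.
Proof.
apply: eq_bigr => beta _; congr (_ * _); apply: eq_bigr => k nk.
by rewrite /set_factor_entry dfwith_out // eq_sym.
Qed.

Lemma model_set_factor_entry x alpha :
  tucker_model (set_factor_entry A i j x) alpha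
  = tucker_model (set_factor_entry A i j 0) alpha
    + (delta G A alpha j * x) *+ (alpha n == i).
Proof.
rewrite !model_delta.
under eq_bigr do rewrite delta_set_factor_entry /set_factor_entry dfwith_in
  mx_set_entryE mulrDr.
rewrite big_split /=; congr (_ + _).
  apply: eq_bigr => t _.
  by rewrite delta_set_factor_entry /set_factor_entry dfwith_in.
rewrite (bigD1 j) //= big1 => [|t /negPf ->]; last by rewrite mulr0n mulr0.
by rewrite eqxx addr0 mulr1n mulrnAr.
Qed.

Lemma model_set_factor_entry0 alpha : alpha n = i ->
  tucker_model (set_factor_entry A i j 0) alpha
  = \sum_(t < J n | t != j) delta G A alpha t * A n i t.
Proof.
move=> alpha_n; rewrite model_delta (bigD1 j) //= /set_factor_entry dfwith_in.
rewrite mxE alpha_n !eqxx mulr0 add0r; apply: eq_bigr => t /negPf tj.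
by rewrite mxE tj andbF -/(set_factor_entry A i j 0) delta_set_factor_entry.
Qed.

(** Exchanging the sums over [t] and [alpha] turns the [v_fm] terms into the model at [x = 0]. Thus
    [g_fm] is the derivative at 0 of the squared error. *)
Lemma g_fmE :
  g_fm X Omega G A i j
  = \sum_(alpha in Omega_slice Omega i)
      - 2 * (X alpha - tucker_model (set_factor_entry A i j 0) alpha)
      * delta G A alpha j.
Proof.
rewrite /g_fm; under [X in _ - X]eq_bigr do rewrite mulr_suml.
rewrite exchange_big -sumrB mulr_sumr; apply: eq_bigr => alpha.
rewrite inE => /andP[_ /eqP alpha_n]; rewrite model_set_factor_entry0 //.
rewrite -mulrA mulrBl mulr_suml; congr (_ * (_ - _)).
by apply: eq_bigr => t _; rewrite mulrAC.
Qed.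

Lemma d_fmE :
  d_fm Omega G A i j
  = 2 * \sum_(alpha in Omega_slice Omega i) delta G A alpha j ^+ 2.
Proof. by []. Qed.

Lemma d_fm_ge0 : 0 <= d_fm Omega G A i j.
Proof. by rewrite d_fmE mulr_ge0 // sumr_ge0 // => *; exact: sqr_ge0. Qed.

Lemma d_fm_eq0 : d_fm Omega G A i j = 0 -> g_fm X Omega G A i j = 0.
Proof.
rewrite d_fmE => /eqP; rewrite mulf_eq0 pnatr_eq0 /= psumr_eq0; last first.
  by move=> *; exact: sqr_ge0.
move=> /allP delta0; rewrite g_fmE big1 // => alpha alphaO.
have := delta0 alpha (mem_index_enum _).
by rewrite alphaO sqrf_eq0 => /eqP ->; rewrite mulr0.
Qed.

Lemma L1_loss_set_factor_entry x :
  L1_loss X Omega lambda G (set_factor_entry A i j x)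
  = L1_loss X Omega lambda G (set_factor_entry A i j 0)
    + d_fm Omega G A i j / 2 * x ^+ 2 + g_fm X Omega G A i j * x
    + lambda * `|x|.
Proof.
have normE : \sum_(k < N) mx_norm1 (set_factor_entry A i j x k)
    = \sum_(k < N) mx_norm1 (set_factor_entry A i j 0 k) + `|x|.
  rewrite (bigD1 n) // [in RHS](bigD1 n) //= /set_factor_entry !dfwith_in.
  rewrite mx_norm1_set_entry addrAC; congr (_ + _ + _).
  by apply: eq_bigr => k nk; rewrite !dfwith_out // eq_sym.
have fitE : \sum_(alpha in Omega)
      (X alpha - tucker_model (set_factor_entry A i j x) alpha) ^+ 2
    = \sum_(alpha in Omega)
        (X alpha - tucker_model (set_factor_entry A i j 0) alpha) ^+ 2
      + (d_fm Omega G A i j / 2 * x ^+ 2 + g_fm X Omega G A i j * x).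
  rewrite d_fmE g_fmE [2 * _]mulrC mulfK ?pnatr_eq0 // !mulr_suml -big_split /=.
  (* The slice sum becomes a conditional sum over [Omega], so that the squares can be expanded index
     by index; off the slice nothing depends on [x]. *)
  under [X in _ = _ + X]eq_bigl do rewrite inE.
  rewrite big_mkcondr -big_split /=; apply: eq_bigr => alpha _.
  rewrite model_set_factor_entry; case: eqP => _; last by rewrite !addr0.
  by rewrite mulr1n; ring.
by rewrite /L1_loss normE -!/(tucker_model _ _) fitE; ring.
Qed.

End SetFactorEntry.

Theorem lemma3 (R : realType) (N : nat) (hN : (1 <= N)%N)
  (I J : 'I_N -> nat)
  (X : tensor R I) (Omega : {set multi_index I})
  (lambda : R) (hlambda : 0 < lambda)
  (G : tensor R J) (A : factors R I J)
  (n : 'I_N) (i_n : 'I_(I n)) (j_n : 'I_(J n)) :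
  let g := g_fm X Omega G A i_n j_n in
  let d := d_fm Omega G A i_n j_n in
  argmin (fun x : R =>
            L1_loss X Omega lambda G (set_factor_entry A i_n j_n x))
  = [set (if lambda < g then (lambda - g) / d
          else if g < - lambda then - (lambda + g) / d
          else 0)]%classic.
Proof.
move=> g d.
(* The constant [c] is the loss with the entry set to 0. *)
rewrite -(@argmin_soft_threshold R
  (L1_loss X Omega lambda G (set_factor_entry A i_n j_n 0))) //.
- congr argmin; apply/funext => x; exact: L1_loss_set_factor_entry.
- exact: d_fm_ge0.
- exact: d_fm_eq0.
Qed.
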